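(* Let $q$ be a prime power, $n\ge5$, $E=\mathbb{F}_q^n$. For each $i\in\{1,\dots,n-2\}$ let $\mathcal{M}_i=\mathcal{U}_{i+1,n}(q)$ and let $\lambda_i=\frac{a_i}{b_i}\in\mathbb{Q}$ (with $a_i,b_i$ positive integers) satisfy $0<\lambda_i<1$ and $\sum_{i=1}^{n-2}\lambda_i=1$. Let $\mathcal{M}=\sum_{i=1}^{n-2}\lambda_i\mathcal{M}_i$ and $\mu=\mathrm{lcm}(b_1,\dots,b_{n-2})$. Then every subspace of $E$ of dimension at most $n-1$ is $\mu$-independent in $\mathcal{M}$. Moreover, if $\mu\ge\lceil n/2\rceil$, then $\mathcal{I}_\mu(\mathcal{M})=\mathcal{L}(E)$.
   Context: $\mathcal{L}(E)$ is the lattice of subspaces of $E$. The uniform $q$-matroid $\mathcal{U}_{k,n}(q)$ has rank function $\rho(V)=\min\{k,\dim V\}$. For $q$-polymatroids with rank functions $\rho_i$ and positive coefficients $\lambda_i$ summing to $1$, $\sum_i\lambda_i\mathcal{M}_i$ is the $q$-polymatroid with rank function $\sum_i\lambda_i\rho_i$. A space $I$ is $\mu$-independent if $\rho(J)\ge\dim(J)/\mu$ for all $J\le I$; $\mathcal{I}_\mu(\mathcal{M})$ denotes the set of $\mu$-independent spaces. *)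

(* Defs.v *)
From HB Require Import structures.
From mathcomp Require Import all_boot all_order all_algebra.
From mathcomp Require Import zify.
From mathcomp Require Import classical_sets.

Set Implicit Arguments.
Unset Strict Implicit.
Unset Printing Implicit Defensive.

Import Order.TTheory GRing.Theory Num.Theory.
Local Open Scope ring_scope.

Record qPolymatroid (F : finFieldType) (E : vectType F) := QPolymatroid {
  qpm_rank :> {vspace E} -> rat;
  qpm_bounds : forall V : {vspace E}, 0 <= qpm_rank V <= (\dim V)%:R;
  qpm_mono : forall V W : {vspace E},
    (V <= W)%VS -> qpm_rank V <= qpm_rank W;
  qpm_submod : forall V W : {vspace E},
    qpm_rank (V + W)%VS + qpm_rank (V :&: W)%VS <= qpm_rank V + qpm_rank W
}.

Section Uniform.
Variables (F : finFieldType) (k n : nat).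

Definition uniform_rank (V : {vspace 'rV[F]_n}) : rat := (minn k (\dim V))%:R.

Lemma uniform_bounds V : 0 <= uniform_rank V <= (\dim V)%:R.
Proof. by rewrite /uniform_rank ler0n ler_nat geq_minr. Qed.

Lemma uniform_mono (V W : {vspace 'rV[F]_n}) :
  (V <= W)%VS -> uniform_rank V <= uniform_rank W.
Proof. by move=> /dimvS; rewrite /uniform_rank ler_nat; lia. Qed.

Lemma uniform_submod (V W : {vspace 'rV[F]_n}) :
  uniform_rank (V + W)%VS + uniform_rank (V :&: W)%VS
    <= uniform_rank V + uniform_rank W.
Proof.
rewrite /uniform_rank -!natrD ler_nat.
have := dimv_sum_cap V W.
have := dimvS (capvSl V W); have := dimvS (capvSr V W).
by lia.
Qed.

(* The uniform q-matroid U_{k,n}(q) on F^n, where q = #|F|. *)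
Definition uniform_qmatroid : qPolymatroid 'rV[F]_n :=
  QPolymatroid uniform_bounds uniform_mono uniform_submod.

End Uniform.

Section ConvexCombination.
Variables (F : finFieldType) (E : vectType F) (I : finType) (lam : I -> rat).
Hypothesis lam_gt0 : forall i, 0 < lam i.
Hypothesis lam_sum1 : \sum_i lam i = 1.
Variable M : I -> qPolymatroid E.

Definition conv_rank (V : {vspace E}) : rat := \sum_i lam i * M i V.

Lemma conv_bounds V : 0 <= conv_rank V <= (\dim V)%:R.
Proof.
apply/andP; split.
  apply: sumr_ge0 => i _; apply: mulr_ge0; first exact: ltW.
  by case/andP: (qpm_bounds (M i) V).
rewrite -[leRHS]mul1r -[X in X * _]lam_sum1 mulr_suml; apply: ler_sum => i _.
by rewrite ler_pM2l //; case/andP: (qpm_bounds (M i) V).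
Qed.

Lemma conv_mono (V W : {vspace E}) : (V <= W)%VS -> conv_rank V <= conv_rank W.
Proof. by move=> VW; apply: ler_sum => i _; rewrite ler_pM2l // qpm_mono. Qed.

Lemma conv_submod (V W : {vspace E}) :
  conv_rank (V + W)%VS + conv_rank (V :&: W)%VS <= conv_rank V + conv_rank W.
Proof.
rewrite /conv_rank -!big_split /=; apply: ler_sum => i _.
by rewrite -!mulrDr ler_pM2l // qpm_submod.
Qed.

Definition qpm_conv : qPolymatroid E :=
  QPolymatroid conv_bounds conv_mono conv_submod.

End ConvexCombination.

Definition mu_independent (F : finFieldType) (E : vectType F) (mu : nat)
    (M : qPolymatroid E) (I : {vspace E}) : Prop :=
  forall J : {vspace E}, (J <= I)%VS -> (\dim J)%:R / mu%:R <= M J.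

Definition mu_independent_spaces (F : finFieldType) (E : vectType F) (mu : nat)
    (M : qPolymatroid E) : set {vspace E} :=
  [set I | mu_independent mu M I]%classic.

(* Main.v *)
(** Each [lam i] is at least [1 / mu], so [1 = \sum_i lam i] forces
    [n - 2 <= mu] and hence [n <= 2 mu]. Since every summand of [M] has uniform
    rank at least 2, the rank of [J] is at least [minn 2 (\dim J)], which
    dominates [\dim J / mu] as [\dim J <= n]. Thus every subspace of [F^n] is
    [mu]-independent. *)
Require Import Defs.
From HB Require Import structures.
From mathcomp Require Import all_boot all_order all_algebra.
From mathcomp Require Import classical_sets zify.
Import Order.TTheory GRing.Theory Num.Theory.
Local Open Scope ring_scope.

Lemma biglcmn_gt0 (I : finType) (b : I -> nat) :
  (forall i, (0 < b i)%N) -> (0 < \big[lcmn/1]_i b i)%N.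
Proof.
move=> b_gt0; elim/big_ind: _ => // x y x_gt0 y_gt0.
by rewrite lcmn_gt0 x_gt0.
Qed.

(** As [a i] is at least 1 and [b i] divides the positive lcm [mu], [lam i >= 1 / b i >= 1 / mu];
    summing over [I] gives [#|I| / mu <= 1]. *)
Lemma card_le_denominator_lcm (I : finType) (a b : I -> nat) (lam : I -> rat) :
  (forall i, (0 < a i)%N) -> (forall i, (0 < b i)%N) ->
  (forall i, lam i = (a i)%:R / (b i)%:R) -> \sum_i lam i = 1 ->
  (#|I| <= \big[lcmn/1]_i b i)%N.
Proof.
move=> a_gt0 b_gt0 lamE lam_sum1; set mu := (\big[lcmn/1]_i b i)%N.
have mu_gt0 : (0 < mu)%N by exact: biglcmn_gt0.
have lam_ge i : mu%:R^-1 <= lam i.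
  have bmu : (b i <= mu)%N by rewrite dvdn_leq ?(biglcmn_sup i).
  rewrite lamE (@le_trans _ _ (b i)%:R^-1) //.
    by rewrite lef_pV2 ?posrE ?ltr0n // ler_nat.
  by rewrite ler_peMl ?invr_ge0 ?ler0n // ler1n.
have : \sum_(i : I) mu%:R^-1 <= 1 :> rat by rewrite -[leRHS]lam_sum1 ler_sum.
by rewrite sumr_const -[leLHS]mulr_natl ler_pdivrMr ?ltr0n // mul1r ler_nat.
Qed.

(** The weights sum to 1, so [c] is the weighted sum of copies of itself and the comparison is
    termwise. *)
Lemma qpm_conv_ge (F : finFieldType) (E : vectType F) (I : finType)
    (lam : I -> rat) (lam_gt0 : forall i, 0 < lam i)
    (lam_sum1 : \sum_i lam i = 1) (M : I -> qPolymatroid E) (V : {vspace E})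
    (c : rat) :
  (forall i, c <= M i V) -> c <= qpm_conv lam_gt0 lam_sum1 M V.
Proof.
move=> cM; rewrite -[c]mul1r -[X in X * _]lam_sum1 mulr_suml.
by apply: ler_sum => i _; rewrite ler_pM2l.
Qed.

Theorem theorem6p5 (F : finFieldType) (n : nat) (n_ge5 : (5 <= n)%N)
    (a b : 'I_(n - 2) -> nat) (lam : 'I_(n - 2) -> rat)
    (a_gt0 : forall i, (0 < a i)%N) (b_gt0 : forall i, (0 < b i)%N)
    (lamE : forall i, lam i = (a i)%:R / (b i)%:R)
    (lam_gt0 : forall i, 0 < lam i) (lam_lt1 : forall i, lam i < 1)
    (lam_sum1 : \sum_i lam i = 1) :
  (* The index i : 'I_(n - 2) is 0-based: it stands for i.+1 in 1, ..., n - 2. *)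
  let M := qpm_conv lam_gt0 lam_sum1
             (fun i : 'I_(n - 2) => uniform_qmatroid F i.+2 n) in
  let mu := (\big[lcmn/1]_i b i)%N in
  (forall V : {vspace 'rV[F]_n}, (\dim V <= n - 1)%N -> mu_independent mu M V)
  /\ ((uphalf n <= mu)%N ->
      mu_independent_spaces mu M = [set: {vspace 'rV[F]_n}]%classic).
Proof.
move=> M mu.
have mu_gt0 : (0 < mu)%N by exact: biglcmn_gt0.
have mu_ge : (n - 2 <= mu)%N.
  by rewrite -{1}[(n - 2)%N]card_ord; apply: card_le_denominator_lcm lamE _.
have indep V : mu_independent mu M V.
  move=> J _; have dimJ : (\dim J <= n)%N.
    by have := dimvS (subvf J); rewrite dimvf /dim /= mul1n.
  apply: (@le_trans _ _ (minn 2 (\dim J))%:R).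
    (* If [\dim J <= 1], [mu >= 1] suffices; otherwise [\dim J <= n <= 2 * (n - 2) <= 2 * mu], where
       the middle step uses [n >= 4]. *)
    by rewrite ler_pdivrMr ?ltr0n // -natrM ler_nat; nia.
  (* The smallest uniform rank, at index 0, is 2. *)
  by apply: qpm_conv_ge => i; rewrite ler_nat leq_min geq_min geq_minr.
split=> [V _|_]; first exact: indep.
by apply/seteqP; split=> V _ //; exact: indep.
Qed.
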